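(* Let $X$ be a Banach holomorphic function space on the open unit disk $\mathbb{D}$. Then $X$ admits a linear polynomial approximation scheme if and only if $X$ contains a dense subspace of polynomials (i.e. the set of polynomials belonging to $X$ is norm-dense in $X$) and $X$ has the bounded approximation property.
   Context: $\mathbb{D}$ denotes the open unit disk in $\mathbb{C}$, and $\mathrm{Hol}(\mathbb{D})$ the Fréchet space of holomorphic functions on $\mathbb{D}$ with the topology of uniform convergence on compact sets. A Banach holomorphic function space on $\mathbb{D}$ is a (complex) Banach space $X$ that is a subset (linear subspace) of $\mathrm{Hol}(\mathbb{D})$ such that the inclusion map $X\hookrightarrow\mathrm{Hol}(\mathbb{D})$ is continuous. It is not assumed that $X$ contains all polynomials. A linear polynomial approximation scheme for $X$ is a sequence of continuous linear operators $T_n:X\to X$ such that, for each $f\in X$, the functions $T_n(f)$ are polynomials and $\|T_n(f)-f\|_X\to0$ as $n\to\infty$. A Banach space $(Y,\|\cdot\|)$ has the bounded approximation property if there is a constant $M$ such that, for every compact subset $K$ of $Y$ and every $\epsilon>0$, there is a bounded finite-rank linear operator $T:Y\to Y$ with $\|T\|\le M$ and $\|Ty-y\|\le\epsilon$ for all $y\in K$. *)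

(* Defs.v *)
From HB Require Import structures.
From mathcomp Require Import all_boot all_order all_algebra.
From mathcomp Require Import complex.
From mathcomp Require Import all_classical all_reals all_analysis.

Set Implicit Arguments.
Unset Strict Implicit.
Unset Printing Implicit Defensive.

Import Order.TTheory GRing.Theory Num.Theory.
Import numFieldNormedType.Exports.

Local Open Scope classical_set_scope.
Local Open Scope ring_scope.

(* The library puts the topology and the normed module structure of the complex
   numbers on [R[i]^o], not on [R[i]]. *)
Notation Cplx R := (complex (Real.sort R))^o.

Definition unit_disk (R : realType) : set (Cplx R) := [set z | `|z| < 1].
Arguments unit_disk : clear implicits.

(* [unit_disk R] is used as a type through the coercion of sets to types; this
   type has the topology induced by [Cplx R]. *)
Notation disk_fun R := (unit_disk R -> Cplx R).

(* ['valL_0 f] is the extension of [f] by [0] off the disk; the disk being open,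
   complex differentiability at a point of the disk only depends on [f]. *)
Definition holomorphic (R : realType) (f : disk_fun R) :=
  forall z : Cplx R, unit_disk R z -> derivable ('valL_0 f) z 1.

(* A Banach space of holomorphic functions is encoded as a Banach space [X]
   together with its inclusion into the functions on the disk. The topology of
   [Hol(D)] is the one it inherits, as a subspace, from the topology of compact
   convergence on all functions on the disk. *)
Definition banach_holomorphic_function_space (R : realType)
    (X : completeNormedModType R[i]) (incl : {linear X -> disk_fun R}) :=
  [/\ injective incl,
      forall f, holomorphic (incl f)
    & continuous (incl : X -> {family compact, unit_disk R -> Cplx R})].

Definition is_polynomial (R : realType) (f : disk_fun R) :=
  exists p : {poly R[i]}, forall z : unit_disk R, f z = p.[set_val z].

Definition linear_polynomial_approximation_scheme (R : realType)
    (X : completeNormedModType R[i]) (incl : {linear X -> disk_fun R})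
    (T : nat -> {linear X -> X}) :=
  (forall n, continuous (T n)) /\
  forall f : X, (forall n, is_polynomial (incl (T n f))) /\
                T n f @[n --> \oo] --> f.

Definition finite_rank (K : numFieldType) (Y Z : lmodType K) (T : Y -> Z) :=
  exists (n : nat) (e : 'I_n -> Z),
    range T = range (fun c : 'I_n -> K => \sum_(i < n) c i *: e i).

Definition bounded_approximation_property (K : numFieldType)
    (Y : normedModType K) :=
  exists2 M : K, 0 <= M &
    forall (A : set Y) (eps : K), compact A -> 0 < eps ->
    exists T : {linear Y -> Y},
      [/\ finite_rank T,
          forall y, `|T y| <= M * `|y|
        & forall y, A y -> `|T y - y| <= eps].

(* Main.v *)
Require Import Defs.
From HB Require Import structures.
From mathcomp Require Import all_boot all_order all_algebra.
From mathcomp Require Import complex.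
From mathcomp Require Import all_classical all_reals all_analysis.
From mathcomp Require Import qpoly.

Set Implicit Arguments.
Unset Strict Implicit.
Unset Printing Implicit Defensive.

Import Order.TTheory GRing.Theory Num.Theory.
Import numFieldNormedType.Exports.

Local Open Scope classical_set_scope.
Local Open Scope ring_scope.

(** The set of polynomials in [X] is an increasing union of finite-dimensional
spaces, namely those of polynomials of bounded degree; both directions rest on
this countability.

Suppose that a scheme [T] is given. For fixed [n], the space [X] is the union
over [d] of the subspaces of those [x] such that [T n x] has degree at most [d].
Each of them is closed, because having degree at most [d] is expressed by linear
relations between point evaluations, through Lagrange interpolation
([closed_poly_of_size]). By Baire's theorem ([closed_cover_ball]) one of these
subspaces has an interior point, so it is [X], and [T n] has finite rank
([poly_valued_finite_rank]). The operators converge pointwise, so they are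
uniformly bounded ([uniform_boundedness]), and a uniformly bounded sequence that
converges pointwise to the identity converges uniformly on compact sets
([equicontinuous_compact]). This is the bounded approximation property.

Conversely, let [b] be a countable family spanning the polynomials of [X]
([polynomial_echelon_family]). The bounded approximation property, used on the
finite sets [b k] with [k < n], gives uniformly bounded finite-rank operators
[T n] that converge to the identity at each [b k] ([bap_sequence]), hence on the
dense subspace of polynomials, hence everywhere ([equicontinuous_dense]). It
remains to replace [T n] by an operator close to it in norm whose values are
polynomials ([finite_rank_poly_approximable]). A finite-rank operator is a sum
of terms [psi x *: u] with [psi] a continuous functional; each vector [u] is
moved slightly to become a polynomial. The functionals [psi] can be chosen
continuous because they are built from point evaluations, which are continuous
on [X] and separate its points ([poly_approximable_projection]). *)

(** * Baire's theorem over the complex numbers *)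

(** A complex number [x] with [0 <= x] is real, so the Archimedean property of [R]
applies to it. *)
Lemma complex_upper_nat (R : realType) (x : R[i]) :
  0 <= x -> exists n : nat, x < n%:R.
Proof.
move=> x0; exists (Num.trunc (complex.Re x)).+1.
rewrite -(RRe_real (ger0_real x0)) /=.
rewrite -[X in _ < X](rmorph_nat (real_complex R)) ltcR.
exact: truncnS_gt.
Qed.

Lemma complex_inv_nat_lt (R : realType) (e : R[i]) :
  0 < e -> \forall n \near \oo, n.+1%:R^-1 < e.
Proof.
move=> e0; have [N] := complex_upper_nat (ltW (etrans (invr_gt0 e) e0)).
move=> eN; exists N => // n /= Nn.
rewrite invf_plt ?posrE ?ltr0Sn//.
by apply: lt_le_trans eN _; rewrite ler_nat; exact: leqW.
Qed.

(** Baire's theorem, in the form used below. If no [F n] contains a ball, every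
ball contains a smaller closed ball disjoint from [F n]; nested balls with radii
tending to zero then shrink to a point outside all the [F n]. *)
Lemma closed_cover_ball (R : realType) (X : completeNormedModType R[i])
    (F : nat -> set X) :
  (forall n, closed (F n)) -> (forall x, exists n, F n x) ->
  exists n x (r : R[i]), 0 < r /\ forall y, `|x - y| < r -> F n y.
Proof.
move=> clF cov; apply: contrapT => nF.
have step (n : nat) (b : X * {posnum R[i]}) :
    exists c : X * {posnum R[i]}, [/\ (c.2%:num <= n.+1%:R^-1),
      (forall y, `|c.1 - y| <= c.2%:num -> `|b.1 - y| <= b.2%:num) &
      (forall y, `|c.1 - y| <= c.2%:num -> ~ F n y)].
  case: b => x r /=.
  have [y xy nFy] : exists2 y, `|x - y| < r%:num & ~ F n y.
    apply: contrapT => H; apply: nF; exists n, x, r%:num; split => // y xy.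
    by apply: contrapT => nFy; apply: H; exists y.
  have /nbhs_normP[e /= e0 He] : nbhs y (~` F n).
    by apply: open_nbhs_nbhs; split => //; exact/closed_openC.
  near (0 : R[i])^'+ => s.
  have s0 : 0 < s by near: s; exact: nbhs_right_gt.
  exists (y, PosNum s0) => /=; split.
  - by near: s; apply: nbhs_right_le; rewrite invr_gt0.
  - move=> z yz; rewrite -(subrKA y) (le_trans (ler_normD _ _))// -lerBrDl.
    rewrite (le_trans yz)//; near: s; apply: nbhs_right_le.
    by rewrite subr_gt0.
  - move=> z yz; apply: (He z); apply: le_lt_trans yz _.
    by near: s; exact: nbhs_right_lt.
pose G (nb : nat * (X * {posnum R[i]})) := projT1 (cid (step nb.1 nb.2)).
have GP n b := projT2 (cid (step n b)).
pose ar := fix ar n := if n is p.+1 then G (p, ar p)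
  else (0 : X, PosNum (@ltr01 R[i])).
have radE n : (ar n.+1).2%:num <= n.+1%:R^-1 by have [] := GP n (ar n).
have nest n m y : (n <= m)%N ->
    `|(ar m).1 - y| <= (ar m).2%:num -> `|(ar n).1 - y| <= (ar n).2%:num.
  elim: m => [|m IH]; first by rewrite leqn0 => /eqP ->.
  rewrite leq_eqVlt => /orP[/eqP -> //|/IH{}IH].
  by have [_ H _] := GP m (ar m) => /H.
have nestc n m : (n <= m)%N -> `|(ar n).1 - (ar m).1| <= (ar n).2%:num.
  by move=> nm; apply: nest nm _; rewrite subrr normr0.
have cvga : cvg ((ar n).1 @[n --> \oo]).
  apply: cauchy_cvg; apply: cauchy_exP => e e0.
  have [N _ HN] := complex_inv_nat_lt e0.
  exists (ar N.+1).1; exists N.+1 => // m /= Nm.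
  rewrite -ball_normE /=; apply: le_lt_trans (nestc _ _ Nm) _.
  by apply: le_lt_trans (radE N) _; apply: (HN N); exact: leqnn.
have [l al] : exists l : X, (ar n).1 @[n --> \oo] --> l by apply/cvg_ex.
have inl n : `|(ar n).1 - l| <= (ar n).2%:num.
  apply/ler_addgt0Pr => e e0.
  have /cvgrPdist_le/(_ e e0)[N _ HN] := al.
  rewrite -(subrKA (ar (n + N)%N).1) (le_trans (ler_normD _ _))// lerD//.
    by apply: nestc; exact: leq_addr.
  by rewrite distrC; apply: HN; exact: leq_addl.
have [n Fnl] := cov l.
by have [_ _ /(_ l (inl n.+1))] := GP n (ar n).
Unshelve. all: by end_near. Qed.

(** * Bounded sequences of operators *)

Lemma closed_norm_le (K : numFieldType) (V : normedModType K) (c : K) :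
  closed [set x : V | `|x| <= c].
Proof.
move=> x clx; apply/ler_addgt0Pr => e e0.
have [y [/= yc xy]] := clx _ (nbhsx_ballx x e e0).
rewrite -ball_normE /= in xy.
rewrite -(subrK y x) (le_trans (ler_normD _ _))// addrC lerD//.
exact: ltW.
Qed.

Lemma continuous_linearP (K : numFieldType) (V W : normedModType K)
    (f : {linear V -> W}) :
  continuous f <-> exists2 M : K, 0 < M & forall x, `|f x| <= M * `|x|.
Proof.
rewrite -linear_bounded_continuous linear_boundedP; split.
  by move=> /pinfty_ex_gt0.
move=> [M M0 fM]; exists M; split; first exact: gtr0_real.
by move=> r /ltW Mr x; apply: le_trans (fM x) _; rewrite ler_wpM2r.
Qed.

Lemma linear_le_of_ball (K : numFieldType) (V W : normedModType K)
    (f : {linear V -> W}) (r c : K) : 0 < r ->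
  (forall x, `|x| < r -> `|f x| <= c) -> forall x, `|f x| <= 2 * c / r * `|x|.
Proof.
move=> r0 fc x; have [->|x0] := eqVneq x 0.
  by rewrite linear0 !normr0 mulr0.
have nx0 : 0 < `|x| by rewrite normr_gt0.
have [t t0 tE] : exists2 t, 0 < t & t * `|x| = r / 2.
  by exists (r / 2 / `|x|); rewrite ?divr_gt0// divfK ?gt_eqF.
have : `|f (t *: x)| <= c.
  by apply: fc; rewrite normrZ gtr0_norm// tE ltr_pdivrMr// ltr_pMr// ltr1n.
rewrite linearZ /= normrZ gtr0_norm// => tc.
rewrite -(ler_pM2l t0) (le_trans tc)// mulrCA tE.
by rewrite mulrA divfK ?gt_eqF// mulrAC divff ?pnatr_eq0// mul1r.
Qed.

(** The Banach-Steinhaus theorem for sequences: the closed sets where all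
[`|T n x|] are at most [N] cover the space, so one of them contains a ball. *)
Lemma uniform_boundedness (R : realType) (X : completeNormedModType R[i])
    (Y : normedModType R[i]) (T : nat -> {linear X -> Y}) :
  (forall n, continuous (T n)) -> (forall x, bounded_fun (fun n => T n x)) ->
  exists2 M : R[i], 0 < M & forall n x, `|T n x| <= M * `|x|.
Proof.
move=> cT bT.
pose F (N : nat) := \bigcap_n [set x | `|T n x| <= N%:R].
have [|x|N [a [r [r0 ar]]]] := @closed_cover_ball R X F.
- move=> N; apply: closed_bigI => n _.
  apply: (@preimage_closed _ _ (T n) [set y | `|y| <= N%:R]).
    by move=> x _; exact: cT.
  exact: closed_norm_le.
- have /pinfty_ex_gt0[M M0 bM] := bT x.
  have [N MN] := complex_upper_nat (ltW M0).
  by exists N => n _ /=; apply: le_trans (bM n I) (ltW MN).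
have N0 : 0 <= N%:R + N%:R :> R[i] by rewrite addr_ge0.
(* the added [1] makes the bound positive even if [N] is zero *)
exists (2 * (N%:R + N%:R) / r + 1) => [|n x].
  by rewrite ltr_wpDl// divr_ge0 ?mulr_ge0// ltW.
rewrite mulrDl mul1r ler_wpDr//; apply: linear_le_of_ball => // y yr.
(* a ball around [a] is moved to the origin as a difference of its points *)
(* a difference of points of the ball around [a] is a vector near the origin *)
have -> : T n y = T n (y + a) - T n a by rewrite linearD addrK.
rewrite (le_trans (ler_normB _ _))// lerD//; apply: ar => //.
  by rewrite opprD addrCA subrr addr0 normrN.
by rewrite subrr normr0.
Qed.

(** Near a point [x], the defect [T n y - y] differs from [T n x - x] by at most
[(M + 1) * `|x - y|], so it is small for all [y] near [x] and all large [n];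
compactness makes the bound on [n] uniform. *)
Lemma equicontinuous_compact (K : numFieldType) (X : normedModType K)
    (T : nat -> {linear X -> X}) (M : K) (A : set X) (eps : K) :
  0 < M -> (forall n x, `|T n x| <= M * `|x|) ->
  (forall x, T n x @[n --> \oo] --> x) -> compact A -> 0 < eps ->
  \forall n \near \oo, forall x, A x -> `|T n x - x| <= eps.
Proof.
move=> M0 bT cT /compact_near_coveringP cA eps0.
apply: (cA _ _ (fun n x => `|T n x - x| <= eps)) => x Ax.
have e2 : 0 < eps / 2 by rewrite divr_gt0.
have M1 : 0 < M + 1 by rewrite addr_gt0.
near=> y n => /=.
have -> : T n y - y = T n (y - x) - (y - x) + (T n x - x).
  by rewrite linearB /= opprB [RHS]addrAC !subrKA.
rewrite (le_trans (ler_normD _ _))// [leRHS]splitr lerD//; last first.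
  near: n; move: (cT x) => /cvgrPdist_le/(_ _ e2); apply: filterS => n.
  by rewrite distrC.
rewrite (le_trans (ler_normB _ _))//.
rewrite (@le_trans _ _ ((M + 1) * `|x - y|))//.
  by rewrite mulrDl mul1r distrC lerD// distrC.
rewrite -ler_pdivlMl//; near: y.
apply/nbhs_normP; exists ((M + 1)^-1 * (eps / 2)) => /=.
  by rewrite mulr_gt0// invr_gt0.
by move=> y /ltW.
Unshelve. all: by end_near. Qed.

Lemma equicontinuous_dense (K : numFieldType) (X : normedModType K)
    (T : nat -> {linear X -> X}) (M : K) (S : set X) :
  0 < M -> (forall n x, `|T n x| <= M * `|x|) -> dense S ->
  (forall x, S x -> T n x @[n --> \oo] --> x) ->
  forall x, T n x @[n --> \oo] --> x.
Proof.
move=> M0 bT dS cS x; apply/cvgrPdist_le => e e0.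
have e2 : 0 < e / 2 by rewrite divr_gt0.
have M1 : 0 < M + 1 by rewrite addr_gt0.
have d0 : 0 < (M + 1)^-1 * (e / 2) by rewrite mulr_gt0// invr_gt0.
have [|y [/= xy Sy]] := dS (ball x ((M + 1)^-1 * (e / 2))) _ (ball_open _ _).
  by exists x; exact: ballxx.
rewrite -ball_normE /= in xy.
move: (cS _ Sy) => /cvgrPdist_le/(_ _ e2); apply: filterS => n yn.
have -> : x - T n x = (x - y) - T n (x - y) + (y - T n y).
  by rewrite linearB /= opprB [RHS]addrAC !subrKA.
rewrite (le_trans (ler_normD _ _))// [leRHS]splitr lerD//.
rewrite (le_trans (ler_normB _ _))// (@le_trans _ _ ((M + 1) * `|x - y|))//.
  by rewrite mulrDl mul1r addrC lerD.
by rewrite -ler_pdivlMl//; exact: ltW.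
Qed.

(** * Polynomials of bounded degree *)

Definition poly_of_size (R : realType) (n : nat) (f : disk_fun R) :=
  exists2 p : {poly R[i]}, (size p <= n)%N &
    forall z : unit_disk R, f z = p.[set_val z].

Lemma is_polynomialE (R : realType) (f : disk_fun R) :
  is_polynomial f <-> exists n, poly_of_size n f.
Proof.
split=> [[p pf]|[n [p _ pf]]]; last by exists p.
by exists (size p), p.
Qed.

Lemma is_polynomialD (R : realType) (f g : disk_fun R) :
  is_polynomial f -> is_polynomial g -> is_polynomial (f + g).
Proof.
by move=> [p fp] [q gq]; exists (p + q) => z; rewrite hornerD -fp -gq.
Qed.

Lemma is_polynomialZ (R : realType) (a : R[i]) (f : disk_fun R) :
  is_polynomial f -> is_polynomial (a *: f).
Proof. by move=> [p fp]; exists (a *: p) => z; rewrite hornerZ -fp. Qed.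

Lemma poly_of_sizeB (R : realType) (n : nat) (f g : disk_fun R) :
  poly_of_size n f -> poly_of_size n g -> poly_of_size n (f - g).
Proof.
move=> [p sp fp] [q sq gq]; exists (p - q).
  by rewrite (leq_trans (size_polyD _ _))// size_polyN geq_max sp.
by move=> z; rewrite hornerD hornerN -fp -gq.
Qed.

Lemma poly_of_sizeZ (R : realType) (n : nat) (a : R[i]) (f : disk_fun R) :
  poly_of_size n f -> poly_of_size n (a *: f).
Proof.
move=> [p sp fp]; exists (a *: p); last by move=> z; rewrite hornerZ -fp.
exact: leq_trans (size_scale_leq _ _) sp.
Qed.

(** Cancelling the leading terms lowers the degree. *)
Lemma poly_of_sizeB_lead (R : realType) (n : nat) (f g : disk_fun R)
    (p q : {poly R[i]}) : size p = n.+1 -> size q = n.+1 ->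
  (forall z, f z = p.[set_val z]) -> (forall z, g z = q.[set_val z]) ->
  poly_of_size n (f - (lead_coef p / lead_coef q) *: g).
Proof.
move=> sp sq fp gq; exists (p - (lead_coef p / lead_coef q) *: q); last first.
  by move=> z; rewrite hornerD hornerN hornerZ -fp -gq.
have lq0 : lead_coef q != 0 by rewrite lead_coef_eq0 -size_poly_eq0 sq.
apply/leq_sizeP => j nj; rewrite coefB coefZ.
have [->|jn] := eqVneq j n.
  by rewrite /lead_coef sp sq /= divfK ?subrr//; rewrite /lead_coef sq in lq0.
have {}nj : (n < j)%N by rewrite ltn_neqAle eq_sym jn.
by rewrite !nth_default ?sp ?sq// mulr0 subrr.
Qed.

(** For each [k], let [b k] be an element of [W] that is a polynomial of degree
exactly [k], if there is one, and [0] otherwise. Subtracting multiples of the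
[b k], highest degree first, reduces every polynomial of [W] to zero. Used with
[W] the range of an operator, and with [W] the set of all polynomials of [X]. *)
Lemma polynomial_echelon_family (R : realType) (X : lmodType R[i])
    (incl : {linear X -> disk_fun R}) (W : set X) :
  injective incl -> W 0 -> (forall a x y, W x -> W y -> W (x - a *: y)) ->
  exists2 b : nat -> X, forall k, W (b k) &
    forall n x, W x -> poly_of_size n (incl x) ->
      exists c : 'I_n -> R[i], x = \sum_(i < n) c i *: b i.
Proof.
move=> incl_inj W0 WB.
pose Q k x := W x /\ exists2 p : {poly R[i]}, size p = k.+1 &
  forall z : unit_disk R, incl x z = p.[set_val z].
have step k : exists x, W x /\ ((exists y, Q k y) -> Q k x).
  have [[x Qx]|nQ] := pselect (exists x, Q k x); last by exists 0.
  by exists x; split => //; case: Qx.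
have [b bP] := choice step.
exists b => [k|]; first by have [] := bP k.
elim=> [|n IH] x Wx.
  move=> [p]; rewrite leqn0 size_poly_eq0 => /eqP -> px.
  exists (fun=> 0); rewrite big_ord0; apply: incl_inj; rewrite linear0.
  by apply/funext => z; rewrite px horner0.
have small y : W y -> poly_of_size n (incl y) -> forall a,
    exists c : 'I_n.+1 -> R[i], y + a *: b n = \sum_(i < n.+1) c i *: b i.
  move=> Wy /(IH y Wy)[c ->] a.
  (* [insub i] fails only at the last index, which carries [a] *)
  exists (fun i => if insub (i : nat) is Some j then c j else a).
  rewrite big_ord_recr /= insubN ?ltnn//; congr +%R.
  by apply: eq_bigr => i _; rewrite valK.
move=> [p sp px]; move: sp; rewrite leq_eqVlt => /orP[/eqP sp|sp]; last first.
  have [|c] := small x Wx _ 0; first by exists p.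
  by rewrite scale0r addr0 => xE; exists c.
have [Wb [|_ [q sq qb]]] := bP n.
  by exists x; split => //; exists p.
have [|c cE] := small _ (WB (lead_coef p / lead_coef q) _ _ Wx Wb) _
  (lead_coef p / lead_coef q); last by exists c; rewrite -cE subrK.
rewrite linearB linearZ /=; exact: poly_of_sizeB_lead.
Qed.

(** Any injective sequence of points of the disk would serve for the
interpolation. *)
Definition disk_sample (R : realType) (k : nat) : R[i] := k.+2%:R^-1.

Lemma disk_sample_inj (R : realType) : injective (@disk_sample R).
Proof.
by move=> i j /invr_inj /eqP; rewrite eqr_nat !eqSS => /eqP.
Qed.

Lemma disk_sample_in (R : realType) (k : nat) :
  unit_disk R (disk_sample R k).
Proof.
rewrite /unit_disk/= /disk_sample ger0_norm ?invr_ge0//.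
by rewrite invf_lt1// ltr1n.
Qed.

Definition disk_pt (R : realType) (k : nat) : unit_disk R :=
  SigSub (mem_set (disk_sample_in R k)).

(** Lagrange interpolation turns the existence of a polynomial of bounded degree
into linear equations on the values of [f]. *)
Lemma poly_of_size_lagrange (R : realType) (n : nat) (f : disk_fun R) :
  poly_of_size n.+1 f <-> forall z : unit_disk R,
    f z = \sum_(i < n.+1) f (disk_pt R i) *
      (tnth (lagrange n.+1 (@disk_sample R)) i : {poly R[i]}).[set_val z].
Proof.
have lag := @lagrange_gen _ n.+1 _ (ltn0Sn n) (@disk_sample_inj R).
split=> [[p sp fp] z|fE].
  rewrite fp [in LHS](lag _ sp) horner_sum; apply: eq_bigr => i _.
  by rewrite hornerM hornerC fp.
exists (\sum_(i < n.+1) f (disk_pt R i) *: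
  (tnth (lagrange n.+1 (@disk_sample R)) i : {poly R[i]})).
  apply: (leq_trans (size_sum _ _ _)); apply/bigmax_leqP => i _.
  by apply: (leq_trans (size_scale_leq _ _)); exact: size_npoly.
by move=> z; rewrite fE horner_sum; apply: eq_bigr => i _; rewrite hornerZ.
Qed.

(** * Operators with polynomial values *)

Section PointEvaluations.
Variables (R : realType) (X : normedModType R[i]).
Variable incl : {linear X -> disk_fun R}.
Hypothesis eval_continuous :
  forall z : unit_disk R, continuous (fun x : X => incl x z).

Lemma closed_poly_of_size (n : nat) :
  closed [set x : X | poly_of_size n.+1 (incl x)].
Proof.
pose L (z : unit_disk R) (x : X) : Cplx R := incl x z -
  \sum_(i < n.+1) incl x (disk_pt R i) *
    (tnth (lagrange n.+1 (@disk_sample R)) i : {poly R[i]}).[set_val z].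
have -> : [set x : X | poly_of_size n.+1 (incl x)] =
    \bigcap_z (L z @^-1` [set y | `|y| <= 0]).
  apply/seteqP; split => x /=.
    move=> /poly_of_size_lagrange xE z _ /=.
    by rewrite normr_le0 subr_eq0; apply/eqP; exact: xE.
  move=> xE; apply/poly_of_size_lagrange => z; apply/eqP.
  by rewrite -subr_eq0 -normr_le0; exact: (xE z I).
apply: closed_bigI => z _; apply: preimage_closed; last exact: closed_norm_le.
move=> x _; apply: cvgB; first exact: eval_continuous.
apply: (cvg_big add_continuous) => i _.
by apply: (@cvgMr_tmp (R[i])); exact: eval_continuous.
Qed.

Hypothesis incl_inj : injective incl.
Hypothesis dense_polynomial : dense [set f : X | is_polynomial (incl f)].

(** [P] is a limit, in operator norm, of continuous operators with polynomial
values. *)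
Definition poly_approximable (P : X -> X) :=
  forall d : R[i], 0 < d -> exists S : {linear X -> X},
    [/\ continuous S, forall x, is_polynomial (incl (S x))
      & forall x, `|S x - P x| <= d * `|x|].

Lemma linear_add_rank_one (P : {linear X -> X}) (psi : {linear X -> Cplx R})
    (u : X) : continuous P -> continuous psi ->
  exists2 Q : {linear X -> X}, continuous Q & forall x, Q x = P x + psi x *: u.
Proof.
move=> cP cpsi; pose f x := P x + (psi x : R[i]) *: u.
have lf : linear f.
  move=> a x y; rewrite /f !linearP /= scalerDl scalerDr !addrA.
  by rewrite -scalerA; congr (_ + _); rewrite addrAC.
pose Q : {linear X -> X} := HB.pack f (GRing.isLinear.Build _ _ _ _ f lf).
exists Q => // x; apply: cvgD; first exact: cP.
by apply: cvgZr_tmp; exact: cpsi.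
Qed.

(** Moving [u] to a polynomial within [d / C] changes [psi x *: u] by at most
[d * `|x|] when [psi] is bounded by [C]. *)
Lemma poly_approximable_add_rank_one (P : X -> X)
    (psi : {linear X -> Cplx R}) (u : X) : continuous psi ->
  poly_approximable P -> poly_approximable (fun x => P x + psi x *: u).
Proof.
move=> cpsi aP d d0; have /continuous_linearP[C C0 psiC] := cpsi.
have d2 : 0 < d / 2 by rewrite divr_gt0.
have r0 : 0 < d / 2 / C by rewrite divr_gt0.
have [S [cS pS SP]] := aP _ d2.
have [|q [/= uq pq]] :=
    dense_polynomial (O := ball u (d / 2 / C)) _ (ball_open _ _).
  by exists u; exact: ballxx.
rewrite -ball_normE /= in uq.
have [Q cQ QE] := linear_add_rank_one q cS cpsi.
exists Q; split => // x; rewrite QE.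
  by rewrite linearD linearZ; exact: is_polynomialD (pS x) (is_polynomialZ _ pq).
rewrite opprD addrACA -scalerBr (le_trans (ler_normD _ _))//.
rewrite [d]splitr mulrDl lerD// normrZ distrC.
rewrite (le_trans (ler_pM _ _ (psiC x) (ltW uq)))//.
by rewrite mulrAC [C * _]mulrC divfK ?gt_eqF.
Qed.

(** Induction on [s]. To make [P] fix one more vector [e], put [u = e - P e]. If
[u] is nonzero, it does not vanish at some point [z] of the disk. Then
[psi x = (x - P x)(z) / u(z)] is a continuous functional with [psi e = 1] that
vanishes on the fixed points of [P], so [P x + psi x *: u] fixes them and [e].
As only rank one terms are added, polynomial approximability is preserved. *)
Lemma poly_approximable_projection (s : seq X) :
  exists P : {linear X -> X},
    [/\ continuous P, poly_approximable P & {in s, forall x, P x = x}].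
Proof.
elim: s => [|e s [P [cP aP Ps]]].
  exists (\0 : {linear X -> X}); split => // [x|d d0]; first exact: cvg_cst.
  exists (\0 : {linear X -> X}); split => [x|x|x].
  - exact: cvg_cst.
  - by exists 0 => z; rewrite linear0 horner0.
  - by rewrite subrr normr0 mulr_ge0// ltW.
have [Pe|Pe] := eqVneq (P e) e.
  by exists P; split => // x; rewrite inE => /orP[/eqP ->//|/Ps].
pose u := e - P e.
have [z uz] : exists z, incl u z != 0.
  apply: contrapT => H; move/eqP: Pe; apply; apply/esym/eqP; rewrite -subr_eq0.
  apply/eqP/incl_inj; rewrite linear0; apply/funext => z.
  by apply/eqP/negPn/negP => uz; apply: H; exists z.
pose f (x : X) : Cplx R := (incl u z)^-1 * incl (x - P x) z.
have lf : linear f.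
  move=> a x y; rewrite /f [P _]linearP /=.
  rewrite (_ : a *: x + y - (a *: P x + P y) = a *: (x - P x) + (y - P y)).
    by rewrite linearP mulrDr mulrCA.
  by rewrite scalerBr opprD addrACA.
pose psi : {linear X -> Cplx R} := HB.pack f (GRing.isLinear.Build _ _ _ _ f lf).
have cpsi : continuous psi.
  move=> x; apply: (@cvgMl_tmp R[i]).
  apply: (@continuous_comp _ _ _ (fun x => x - P x) (fun x => incl x z)).
    by apply: cvgB => //; exact: cP.
  exact: eval_continuous.
have [Q cQ QE] := linear_add_rank_one u cP cpsi.
exists Q; split => //.
  have -> : (Q : X -> X) = (fun x => P x + psi x *: u) by apply/funext.
  exact: poly_approximable_add_rank_one.
move=> x; rewrite inE QE /= /f => /orP[/eqP ->|/Ps ->].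
  by rewrite mulVf// scale1r addrC subrK.
by rewrite subrr linear0 mulr0 scale0r addr0.
Qed.

(** If [P] fixes the range of [T], then [T = P \o T], so the approximation
of [P] can be composed with [T]. *)
Lemma finite_rank_poly_approximable (T : {linear X -> X}) :
  continuous T -> finite_rank T -> poly_approximable T.
Proof.
move=> cT [n [e Te]] d d0.
have [P [cP aP Pe]] := poly_approximable_projection [seq e i | i <- enum 'I_n].
have PT x : P (T x) = T x.
  have : range T (T x) by exists x.
  rewrite Te => -[c _ <-]; rewrite linear_sum; apply: eq_bigr => i _.
  by rewrite linearZ /= Pe//; apply: map_f; rewrite mem_enum.
have /continuous_linearP[C C0 TC] := cT.
have [S [cS pS SP]] := aP (d / C) (divr_gt0 d0 C0).
exists (S \o T : {linear X -> X}); split => [x|x|x].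
- by apply: continuous_comp; [exact: cT|exact: cS].
- exact: pS.
- rewrite /= -{2}PT (le_trans (SP _))//.
  by rewrite mulrAC ler_pdivrMr// -mulrA ler_pM2l// mulrC.
Qed.

End PointEvaluations.

(** * Finite rank and the bounded approximation property *)

Lemma cvg_of_le_inv_nat (R : realType) (X : normedModType R[i])
    (f g : nat -> X) (x : X) (c : R[i]) : 0 <= c ->
  (\forall n \near \oo, `|g n - f n| <= n.+1%:R^-1 * c) ->
  f n @[n --> \oo] --> x -> g n @[n --> \oo] --> x.
Proof.
move=> c0 gf fx; apply/cvgrPdist_le => e e0.
have e2 : 0 < e / 2 by rewrite divr_gt0.
have c1 : 0 < c + 1 by rewrite ltr_wpDl.
near=> n.
rewrite -(subrKA (f n)) (le_trans (ler_normD _ _))// [leRHS]splitr lerD//.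
  by near: n; move: fx => /cvgrPdist_le; apply.
rewrite distrC (@le_trans _ _ (n.+1%:R^-1 * c))//; first by near: n.
rewrite (@le_trans _ _ (n.+1%:R^-1 * (c + 1)))//.
  by rewrite ler_wpM2l ?invr_ge0// lerDl.
rewrite -ler_pdivlMr//; apply/ltW; near: n.
by apply: complex_inv_nat_lt; rewrite divr_gt0.
Unshelve. all: by end_near. Qed.

Lemma bap_sequence (R : realType) (X : normedModType R[i]) (b : nat -> X) :
  bounded_approximation_property X ->
  exists (T : nat -> {linear X -> X}) (M : R[i]),
    [/\ 0 < M, forall n, finite_rank (T n), forall n x, `|T n x| <= M * `|x|
      & forall k, T n (b k) @[n --> \oo] --> b k].
Proof.
move=> [M M0 bap].
have step n : exists T : {linear X -> X}, [/\ finite_rank T,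
    forall x, `|T x| <= M * `|x|
    & forall k, (k < n)%N -> `|T (b k) - b k| <= n.+1%:R^-1].
  have [||T [fT bT aT]] := bap (b @` `I_n) n.+1%:R^-1.
  - by apply: finite_compact; apply: finite_image; exact: finite_II.
  - by rewrite invr_gt0.
  - by exists T; split => // k kn; apply: aT; exists k.
have [T TP] := choice step.
exists T, (M + 1); split => [|n|n x|k].
- by rewrite ltr_wpDl.
- by have [] := TP n.
- have [_ /(_ x) H _] := TP n.
  by rewrite (le_trans H)// ler_wpM2r// lerDl.
- apply: (@cvg_of_le_inv_nat _ _ (fun=> b k) _ _ 1) => //; last exact: cvg_cst.
  by exists k.+1 => // n /= kn; have [_ _ /(_ k kn)] := TP n; rewrite mulr1.
Qed.

(** By Baire's theorem a single bound on the degree holds for [T x] with [x] in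
a ball, and then for all [x], the bound being stable under linear combinations. An
echelon family of the range is then a finite spanning family of it. *)
Lemma poly_valued_finite_rank (R : realType) (X : completeNormedModType R[i])
    (incl : {linear X -> disk_fun R}) (T : {linear X -> X}) :
  injective incl ->
  (forall z : unit_disk R, continuous (fun x : X => incl x z)) ->
  continuous T -> (forall x, is_polynomial (incl (T x))) -> finite_rank T.
Proof.
move=> incl_inj cev cT pT.
pose F n := [set x : X | poly_of_size n.+1 (incl (T x))].
have [|x|d [a [r [r0 ar]]]] := @closed_cover_ball R X F.
- move=> n; apply: (@preimage_closed _ _ T [set y | poly_of_size n.+1 (incl y)]).
    by move=> x _; exact: cT.
  exact: closed_poly_of_size.
- have [p px] := pT x; exists (size p); exists p => //; exact: leqnSn.
have Fall x : poly_of_size d.+1 (incl (T x)).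
  have x1 : 0 < `|x| + 1 by rewrite ltr_wpDl.
  (* [x] is rescaled so that [a + t *: x] lies in the ball *)
  pose t := r / (`|x| + 1); have t0 : 0 < t by rewrite divr_gt0.
  have -> : T x = t^-1 *: (T (a + t *: x) - T a).
    rewrite [T (_ + _)]linearD addrAC subrr add0r linearZ scalerA.
    by rewrite mulVf ?gt_eqF// scale1r.
  rewrite linearZ [incl _]linearB; apply/poly_of_sizeZ/poly_of_sizeB; apply: ar.
    rewrite opprD addNKr normrN normrZ gtr0_norm// mulrAC ltr_pdivrMr//.
    by rewrite ltr_pM2l// ltrDl.
  by rewrite subrr normr0.
have [| |b Wb bE] := @polynomial_echelon_family R X incl (range T) incl_inj.
- by exists 0 => //; rewrite linear0.
- move=> c _ _ [x _ <-] [y _ <-]; exists (x - c *: y) => //.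
  by rewrite linearB linearZ.
have [k|y yb] := @choice nat X (fun k y => T y = b k).
  by have [y _ yb] := Wb k; exists y.
exists d.+1, (fun i => b i); apply/seteqP; split => [_ [x _ <-]|_ [c _ <-]].
  have [|c ->] := bE d.+1 (T x) _ (Fall x); first by exists x.
  by exists c.
exists (\sum_(i < d.+1) c i *: y i) => //.
by rewrite linear_sum; apply: eq_bigr => i _; rewrite linearZ /= yb.
Qed.

Theorem theorem1p1 (R : realType) (X : completeNormedModType R[i])
    (incl : {linear X -> disk_fun R})
    (hX : banach_holomorphic_function_space incl) :
  (exists T : nat -> {linear X -> X},
      linear_polynomial_approximation_scheme incl T) <->
  dense [set f : X | is_polynomial (incl f)] /\
  bounded_approximation_property X.
Proof.
case: hX => incl_inj _ incl_cont.
have cev (z : unit_disk R) : continuous (fun x : X => incl x z).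
  move=> x; move: (incl_cont x) => /pointwise_cvg_compact_family.
  by move/pointwise_cvgP/(_ z).
split=> [[T [cT TP]]|[dP bap]].
- have Tx x : T n x @[n --> \oo] --> x by have [] := TP x.
  have pT n x : is_polynomial (incl (T n x)) by have [] := TP x.
  split=> [U [x Ux] oU|].
    have /Tx[N _ HN] : nbhs x U by apply: open_nbhs_nbhs.
    by exists (T N x); split; [apply: HN => /=|exact: pT].
  have [|M M0 bT] := uniform_boundedness cT.
    by move=> x; apply: cvg_seq_bounded; apply/cvg_ex; exists x.
  exists M => [|A eps cA eps0]; first exact: ltW.
  have [N _ HN] := equicontinuous_compact M0 bT Tx cA eps0.
  exists (T N); split; [|exact: bT|by apply: HN => /=].
  exact: poly_valued_finite_rank (pT N).
pose W := [set f : X | is_polynomial (incl f)].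
have [| |b Wb bE] := @polynomial_echelon_family R X incl W incl_inj.
- by exists 0 => z; rewrite linear0 horner0.
- move=> a x y Wx Wy; rewrite /W /= -scaleNr linearD linearZ.
  by apply: is_polynomialD => //; exact: is_polynomialZ.
have [T [M [M0 fT bT Tb]]] := bap_sequence b bap.
have cT n : continuous (T n) by apply/continuous_linearP; exists M.
have Tx : forall x, T n x @[n --> \oo] --> x.
  apply: (equicontinuous_dense M0 bT dP) => x Wx.
  have /is_polynomialE[d /(bE _ _ Wx)[c ->]] : is_polynomial (incl x) by [].
  under eq_fun do rewrite linear_sum.
  apply: (cvg_big add_continuous) => i _.
  under eq_fun do rewrite linearZ /=.
  apply: cvgZl_tmp; exact: Tb.
have apx n := finite_rank_poly_approximable cev incl_inj dP (cT n) (fT n)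
  (etrans (invr_gt0 _) (ltr0Sn _ n)).
have [S SP] := choice apx.
exists S; split => [n|x]; first by have [] := SP n.
split=> [n|]; first by have [_] := SP n.
apply: (cvg_of_le_inv_nat (normr_ge0 x) _ (Tx x)).
by apply: nearW => n; have [_ _ ] := SP n.
Qed.
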